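(* Fix $0<\delta<\frac12$ and $0<\epsilon<1$, and let $\mathbf{X}$ be a set of $n$ pairwise orthogonal vectors in $\mathbb{S}^{N-1}$. The random $m$-dimensional one-bit map $\mathbf{B}_m:\mathbf{X}\to\mathbb{H}_m$ satisfies the $\delta$-RIP with probability at least $1-\epsilon$ when $$m\geq\frac{\ln\frac{n^2}{\epsilon}}{2\delta^2}.$$
   Context: $\mathbb{S}^{N-1}$ is the unit sphere of $\mathbb{R}^N$, with normalized geodesic metric $d_{geo}(x,y)=\frac{\cos^{-1}(x\cdot y)}{\pi}$. $\mathbb{H}_m=\{0,1\}^m$ is the Hamming cube with normalized metric $d_{\mathbb{H}_m}(u,v)=\frac1m\#\{i:u_i\neq v_i\}$. Random $m$-dimensional one-bit map: let $\theta_1,\dots,\theta_m$ be i.i.d. uniformly distributed random vectors in $\mathbb{S}^{N-1}$ and set $\mathbf{B}_m x=\{\mathrm{sgn}(x\cdot\theta_j)\}_{j=1}^m$, where the two sign values $\pm1$ are identified with the two elements of $\{0,1\}$ (the event $x\cdot\theta_j=0$ has probability zero). Thus $d_{\mathbb{H}_m}(\mathbf{B}_mx,\mathbf{B}_my)=\frac1m\sum_{i=1}^m\frac{|\mathrm{sgn}(x\cdot\theta_i)-\mathrm{sgn}(y\cdot\theta_i)|}{2}$. $\mathbf{B}_m:\mathbf{X}\to\mathbb{H}_m$ has the $\delta$-RIP (restricted isometry property) if $|d_{\mathbb{H}_m}(\mathbf{B}_mx,\mathbf{B}_my)-d_{geo}(x,y)|\leq\delta$ for all pairs $x,y\in\mathbf{X}$.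 *)

(* Defs.v *)
From HB Require Import structures.
From mathcomp Require Import all_boot all_order all_algebra.
From mathcomp Require Import all_classical all_reals all_analysis.

Set Implicit Arguments.
Unset Strict Implicit.
Unset Printing Implicit Defensive.

Import Order.TTheory GRing.Theory Num.Theory.
Import numFieldNormedType.Exports.

Local Open Scope classical_set_scope.
Local Open Scope ring_scope.

(* R^N with its Borel sigma-algebra; vectors are row vectors. *)
Definition borelRow (R : realType) (N : nat) :=
  g_sigma_algebraType (@open 'rV[R]_N).

Definition dotv (R : realType) (N : nat) (x y : 'rV[R]_N) : R :=
  \sum_(i < N) x ord0 i * y ord0 i.

(* The library norm on 'rV[R]_N is the sup norm, so the Euclidean norm is
   spelled out. *)
Definition unit_sphere (R : realType) (N : nat) : set 'rV[R]_N :=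
  [set x | Num.sqrt (dotv x x) = 1].

Definition dgeo (R : realType) (N : nat) (x y : 'rV[R]_N) : R :=
  acos (dotv x y) / pi.

Definition pairwise_orthogonal_set (R : realType) (N : nat)
    (X : set 'rV[R]_N) : Prop :=
  forall x y, X x -> X y -> x <> y -> dotv x y = 0.

Definition hamming_cube (m : nat) := {ffun 'I_m -> bool}.

Definition dhamming (R : realType) (m : nat) (u v : hamming_cube m) : R :=
  #|[set i | u i != v i]|%:R / m%:R.

(* The sign +1 is encoded by true and -1 by false, with sgn 0 = +1. *)
Definition onebit_map (R : realType) (N m : nat) (theta : 'I_m -> 'rV[R]_N)
    (x : 'rV[R]_N) : hamming_cube m :=
  [ffun j => 0 <= dotv x (theta j)].

Definition has_RIP (R : realType) (N m : nat) (delta : R)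
    (X : set 'rV[R]_N) (B : 'rV[R]_N -> hamming_cube m) : Prop :=
  forall x y, X x -> X y -> `|dhamming R (B x) (B y) - dgeo x y| <= delta.

(* The uniform law on the unit sphere: the (unique) Borel probability measure
   carried by the sphere and invariant under the orthogonal group. *)
Definition uniform_on_sphere (R : realType) (N : nat)
    (mu : probability (borelRow R N) R) : Prop :=
  mu (@unit_sphere R N : set (borelRow R N)) = 1%E /\
  forall Q : 'M[R]_N, Q *m Q^T = 1%:M ->
  forall A : set (borelRow R N), measurable A ->
    mu ((fun v : 'rV[R]_N => v *m Q) @^-1` A) = mu A.

Definition mutually_independent (R : realType) (d d' : measure_display)
    (T : measurableType d) (T' : measurableType d') (P : probability T R)
    (m : nat) (theta : 'I_m -> {RV P >-> T'}) : Prop :=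
  forall (J : {set 'I_m}) (A : 'I_m -> set T'),
    (forall j, measurable (A j)) ->
    P (\bigcap_(j in [set` J]) (theta j @^-1` A j)) =
    (\prod_(j in J) P (theta j @^-1` A j))%E.

(* Main.v *)
Require Import Defs.
From mathcomp Require Import all_boot all_order all_algebra.
From mathcomp Require Import all_classical all_reals all_analysis.
From mathcomp Require Import measurable_realfun ring lra.

Set Implicit Arguments.
Unset Strict Implicit.
Unset Printing Implicit Defensive.

Import Order.TTheory GRing.Theory Num.Theory.
Import numFieldNormedType.Exports.

Local Open Scope classical_set_scope.
Local Open Scope ring_scope.

(** Two distinct points [x], [y] of the set are orthogonal, so that their
    normalized geodesic distance is [1/2], while their normalized Hamming
    distance is the frequency, over the independent directions [theta j], of
    the event that [x] and [y] lie on different sides of the hyperplane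
    orthogonal to [theta j]. This event has probability [1/2]
    ([uniform_sign_disagree]): the reflection along [x] preserves the uniform
    law, fixes the scalar product with [y] and negates the one with [x], and
    hence exchanges agreement and disagreement of the two signs, except where
    the scalar product with [x] is zero.

    That exceptional hyperplane is a null set ([uniform_hyperplane]). By
    invariance all hyperplanes through the origin have the same measure [c]. A
    nonzero vector is orthogonal to fewer than [N] points
    [(1, t, t^2, ..., t^(N-1))] of the moment curve, since it is the coefficient
    vector of a polynomial of degree less than [N]; integrating the number of
    points [t < K] that are orthogonal to a random vector gives [K * c <= N] for
    every [K], hence [c = 0].

    By independence, the [m] disagreement bits of a pair are uniformly
    distributed on the cube, so their law is a counting problem. The Chernoff
    method with [cosh t <= exp (t^2 / 2)] and [t = 2 * delta] bounds each of the
    two tails by [exp (- 2 m delta^2)] ([card_tail_le], [prob_hamming_tail]).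
    Each unordered pair has two tails, so there are at most [n^2] tails in total
    and the union bound gives [n^2 * exp (- 2 m delta^2) <= epsilon]. *)

(** * Tails of sums of fair signs *)

(** [sinh x <= x * cosh x] for nonnegative [x], by differentiation. *)
Lemma ler_sinh_xcosh (R : realType) (x : R) :
  0 <= x -> expR x - expR (- x) <= x * (expR x + expR (- x)).
Proof.
move=> x0; rewrite -subr_ge0.
pose G (t : R) := t * (expR t + expR (- t)) - (expR t - expR (- t)).
have dG (t : R) : is_derive t (1 : R) G (t * (expR t - expR (- t))).
  apply: is_derive_eq.
  rewrite /GRing.scale /=; ring.
have -> : 0 = G 0 by rewrite /G oppr0 mul0r subrr subr0.
apply: (@ger0_derive1_ndecry R G 0) => //.
- move=> t; rewrite in_itv /= andbT => t0.
  rewrite derive1E derive_val mulr_ge0 ?(ltW t0)// subr_ge0 ler_expR.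
  lra.
- by apply: derivable_within_continuous => t _; apply: ex_derive.
Qed.

(** [cosh x <= exp (x^2 / 2)]: the product [exp (- t^2 / 2) * cosh t] is
    nonincreasing for nonnegative [t], by the previous lemma. *)
Lemma cosh_le_gauss (R : realType) (x : R) :
  expR x + expR (- x) <= 2 * expR (x ^+ 2 / 2).
Proof.
wlog x0 : x / 0 <= x => [H|].
  have [/H//|/ltW xn] := leP 0 x.
  have := H (- x); rewrite oppr_ge0 opprK sqrrN addrC; exact.
rewrite -[leRHS]mulr1 -[leLHS]mulr1.
pose F (t : R) := expR (- (t ^+ 2 / 2)) * (expR t + expR (- t)).
have dF (t : R) : is_derive t (1 : R) F
   (expR (- (t ^+ 2 / 2)) *
     ((expR t - expR (- t)) - t * (expR t + expR (- t)))).
  apply: is_derive_eq.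
  by rewrite /GRing.scale /=; field.
have : F x <= F 0.
  apply: (@ler0_derive1_nincry R F 0) => //.
  - move=> t; rewrite in_itv /= andbT => t0.
    by rewrite derive1E derive_val pmulr_rle0 ?expR_gt0// subr_le0 ler_sinh_xcosh// ltW.
  - by apply: derivable_within_continuous => t _; apply: ex_derive.
rewrite /F expr0n /= mul0r oppr0 expR0 expRN mulrC mul1r ler_pdivrMr ?expR_gt0//.
by rewrite !mulr1.
Qed.

(** One-sided Hoeffding bound for [m] fair bits, as a count of the points of the
    cube; [c = 1] gives the upper tail and [c = -1] the lower one. For [m = 0]
    the frequency is [0 / 0 = 0] and the bound is [1]. *)
Lemma card_tail_le (R : realType) (m : nat) (delta c : R) : 0 <= delta ->
  c = 1 \/ c = -1 ->
  #|[pred b : {ffun 'I_m -> bool} |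
      delta < c * (#|[pred i | b i]|%:R / m%:R - 1 / 2)]|%:R
    <= 2 ^+ m * expR (- (2 * m%:R * delta ^+ 2)) :> R.
Proof.
move=> d0 hc.
pose s (e : bool) : R := c * (if e then 1 else -1).
have sumE (b : {ffun 'I_m -> bool}) :
    \sum_i s (b i) = 2 * m%:R * (c * (#|[pred i | b i]|%:R / m%:R - 1 / 2)).
  rewrite -mulr_sumr (bigID b) /=.
  rewrite (eq_bigr (fun=> 1)) => [|i ->//]; rewrite sumr_const.
  rewrite (eq_bigr (fun=> -1)) => [|i /negbTE ->//]; rewrite sumr_const.
  have mE : m = (#|[pred i | b i]| + #|[pred i | ~~ b i]|)%N.
    by rewrite -[LHS]card_ord -(cardC [pred i | b i]); congr (_ + _)%N.
  rewrite -/(#|[pred i | b i]|) -/(#|[pred i | ~~ b i]|).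
  move: mE; set k := #|[pred i | b i]|; set k' := #|[pred i | ~~ b i]|.
  move=> mE; change (c * (k%:R + -1 *+ k') = 2 * m%:R * (c * (k%:R / m%:R - 1 / 2))).
  move: k k' mE => k k' mE.
  have [m0|m0] := eqVneq m 0%N.
    move: mE; rewrite m0 => /esym/eqP; rewrite addn_eq0 => /andP[/eqP-> /eqP->].
    by rewrite !mulr0n addr0 mulr0 !mulr0 mul0r.
  move: m0; rewrite -(pnatr_eq0 R) mE natrD mulNrn => m0.
  by field.
(* the parameter of the exponential moment that optimizes the bound *)
pose l := 2 * delta.
have expE (b : {ffun 'I_m -> bool}) : \prod_i expR (l * s (b i)) = expR (l * \sum_i s (b i)).
  by rewrite mulr_sumr expR_sum.
apply: (@le_trans _ _ (\sum_(b : {ffun 'I_m -> bool})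
    expR (l * (\sum_i s (b i) - 2 * m%:R * delta)))).
  rewrite -sum1_card natr_sum big_mkcond /=; apply: ler_sum => b _.
  case: ifPn; rewrite inE ?expR_ge0// => hb.
  rewrite -[leLHS]expR0 ler_expR; apply: mulr_ge0; first by rewrite mulr_ge0.
  rewrite sumE -mulrBr; apply: mulr_ge0; first by rewrite mulr_ge0.
  by rewrite subr_ge0 ltW.
rewrite (eq_bigr (fun b : {ffun 'I_m -> bool} =>
   expR (- (4 * m%:R * delta ^+ 2)) * \prod_i expR (l * s (b i)))); last first.
  by move=> b _; rewrite expE -expRD; congr expR; rewrite /l; ring.
(* the sum over the cube of a product over the coordinates factorizes *)
rewrite -mulr_sumr -(bigA_distr_bigA (fun i e => expR (l * s e))) /=.
rewrite prodr_const card_ord big_bool /=.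
have -> : expR (l * s true) + expR (l * s false) = expR l + expR (- l).
  by rewrite /s; case: hc => ->; rewrite ?mul1r ?mulN1r ?opprK ?mulr1 ?mulrN1// addrC.
apply: (@le_trans _ _ (expR (- (4 * m%:R * delta ^+ 2)) *
    (2 * expR (l ^+ 2 / 2)) ^+ m)).
  rewrite ler_wpM2l ?expR_ge0// lerXn2r ?nnegrE ?addr_ge0 ?mulr_ge0 ?expR_ge0//.
  exact: cosh_le_gauss.
rewrite exprMn mulrCA -expRM_natl -expRD.
rewrite ler_wpM2l ?exprn_ge0// ler_expR /l -mulr_natl.
by rewrite le_eqVlt; apply/orP; left; apply/eqP; field.
Qed.

(** * Scalar products and reflections *)

Lemma dotvE (R : realType) (N : nat) (x y : 'rV[R]_N) :
  dotv x y = (x *m y^T) ord0 ord0.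
Proof. by rewrite mxE; apply: eq_bigr => i _; rewrite mxE. Qed.

Lemma dotvC (R : realType) (N : nat) (x y : 'rV[R]_N) : dotv x y = dotv y x.
Proof. by apply: eq_bigr => i _; rewrite mulrC. Qed.

Lemma dotvBl (R : realType) (N : nat) (x y z : 'rV[R]_N) :
  dotv (x - y) z = dotv x z - dotv y z.
Proof. by rewrite !dotvE mulmxBl !mxE. Qed.

Lemma dotvZl (R : realType) (N : nat) (a : R) (x y : 'rV[R]_N) :
  dotv (a *: x) y = a * dotv x y.
Proof. by rewrite !dotvE -scalemxAl !mxE. Qed.

Lemma dotvNl (R : realType) (N : nat) (x y : 'rV[R]_N) :
  dotv (- x) y = - dotv x y.
Proof. by rewrite -scaleN1r dotvZl mulN1r. Qed.

Lemma dotv_mulmxr (R : realType) (N : nat) (Q : 'M[R]_N) (x v : 'rV[R]_N) :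
  dotv x (v *m Q) = dotv (x *m Q^T) v.
Proof. by rewrite !dotvE trmx_mul mulmxA. Qed.

Lemma dotvv_eq0 (R : realType) (N : nat) (x : 'rV[R]_N) :
  (dotv x x == 0) = (x == 0).
Proof.
apply/idP/eqP => [|->]; last by rewrite dotvE mul0mx mxE.
rewrite psumr_eq0 => [/allP x0|i _]; last by rewrite -expr2 sqr_ge0.
apply/rowP => i; rewrite mxE; apply/eqP.
by have := x0 i (mem_index_enum _); rewrite mulf_eq0 orbb.
Qed.

(** The matrix of the orthogonal reflection in the hyperplane orthogonal to
    [u], acting on row vectors. For [u = 0] it is the identity matrix. *)
Definition reflmx (R : realType) (N : nat) (u : 'rV[R]_N) : 'M[R]_N :=
  1%:M - (2 / dotv u u) *: (u^T *m u).

Lemma mulmx_reflmx (R : realType) (N : nat) (u x : 'rV[R]_N) :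
  x *m reflmx u = x - (2 * dotv x u / dotv u u) *: u.
Proof.
rewrite mulmxBr mulmx1 -scalemxAr mulmxA [x *m u^T]mx11_scalar mul_scalar_mx.
by rewrite scalerA -dotvE mulrAC.
Qed.

Lemma tr_reflmx (R : realType) (N : nat) (u : 'rV[R]_N) :
  (reflmx u)^T = reflmx u.
Proof. by rewrite linearB linearZ /= trmx_mul trmxK trmx1. Qed.

Lemma reflmx_orthogonal (R : realType) (N : nat) (u : 'rV[R]_N) :
  reflmx u *m (reflmx u)^T = 1%:M.
Proof.
rewrite tr_reflmx; have [->|u0] := eqVneq u 0.
  by rewrite /reflmx mulmx0 scaler0 subr0 mulmx1.
rewrite {2}/reflmx mulmxBr mulmx1 -scalemxAr {1 2}/reflmx mulmxBl mul1mx.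
rewrite -scalemxAl mulmxA -[u^T *m u *m u^T]mulmxA [u *m u^T]mx11_scalar -dotvE.
rewrite mul_mx_scalar -scalemxAl scalerA divfK ?dotvv_eq0//.
rewrite (_ : 2 = 1 + 1) // scalerDl scale1r opprD addNKr scalerN.
by rewrite opprK subrK.
Qed.

(** The reflection along the difference of two vectors of the same Euclidean
    norm maps the first to the second. *)
Lemma mulmx_reflmxB (R : realType) (N : nat) (x y : 'rV[R]_N) :
  dotv x x = dotv y y -> x *m reflmx (x - y) = y.
Proof.
move=> xy; have [<-|neq] := eqVneq x y.
  by rewrite mulmx_reflmx subrr scaler0 subr0.
rewrite mulmx_reflmx.
have : dotv (x - y) (x - y) != 0 by rewrite dotvv_eq0 subr_eq0.
have -> : dotv (x - y) (x - y) = 2 * dotv x (x - y).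
  rewrite dotvBl ![dotv _ (x - y)]dotvC !dotvBl -xy (dotvC y x); ring.
by move=> h; rewrite divff// scale1r; exact: subKr.
Qed.

Lemma unit_sphere_neq0 (R : realType) (N : nat) (x : 'rV[R]_N) :
  unit_sphere x -> x != 0.
Proof.
rewrite -dotvv_eq0 /unit_sphere /=; apply: contra_eqN => /eqP ->.
by rewrite sqrtr0 eq_sym oner_eq0.
Qed.

Lemma dotvv_unit_sphere (R : realType) (N : nat) (x : 'rV[R]_N) :
  unit_sphere x -> dotv x x = 1.
Proof.
move=> x1; rewrite -[LHS]sqr_sqrtr ?x1 ?expr1n//.
by apply: sumr_ge0 => i _; rewrite -expr2 sqr_ge0.
Qed.

(** * Measurability of half-spaces, hyperplanes and the sphere *)

Lemma continuous_dotv (R : realType) (N : nat) (x : 'rV[R]_N) :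
  continuous (dotv x).
Proof.
apply: continuous_big => [|i _ v]; first exact: add_continuous.
apply: continuousM; [exact: cst_continuous|exact: coord_continuous].
Qed.

Lemma closed_measurable_borelRow (R : realType) (N : nat) (A : set 'rV[R]_N) :
  closed A -> measurable (A : set (borelRow R N)).
Proof.
move=> cA; rewrite -[A]setCK; apply: measurableC.
by apply: sub_sigma_algebra; exact: closed_openC.
Qed.

Lemma measurable_dotv_ge0 (R : realType) (N : nat) (x : 'rV[R]_N) :
  measurable ([set v | 0 <= dotv x v] : set (borelRow R N)).
Proof.
apply: closed_measurable_borelRow.
apply: (@closed_comp _ _ (dotv x) [set t | 0 <= t]); last exact: closed_ge.
by move=> v _; exact: continuous_dotv.
Qed.

Lemma measurable_dotv_eq0 (R : realType) (N : nat) (x : 'rV[R]_N) :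
  measurable ([set v | dotv x v = 0] : set (borelRow R N)).
Proof.
apply: closed_measurable_borelRow.
apply: (@closed_comp _ _ (dotv x) [set 0]); last exact: closed_eq.
by move=> v _; exact: continuous_dotv.
Qed.

Lemma measurable_sign_disagree (R : realType) (N : nat) (x y : 'rV[R]_N) :
  measurable ([set v | (0 <= dotv x v) != (0 <= dotv y v)]
    : set (borelRow R N)).
Proof.
have mx := measurable_dotv_ge0 x; have my := measurable_dotv_ge0 y.
rewrite [X in measurable X](_ : _ =
  ([set v | 0 <= dotv x v] `\` [set v | 0 <= dotv y v]) `|`
  ([set v | 0 <= dotv y v] `\` [set v | 0 <= dotv x v])).
  by apply: measurableU; exact: measurableD.
apply/seteqP; split=> v /=; case: (0 <= dotv x v); case: (0 <= dotv y v) => //=.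
- by left.
- by right.
- by case=> -[].
- by case=> -[].
Qed.

Lemma measurable_unit_sphere (R : realType) (N : nat) :
  measurable (@unit_sphere R N : set (borelRow R N)).
Proof.
apply: closed_measurable_borelRow.
apply: (@closed_comp _ _ (fun x : 'rV[R]_N => Num.sqrt (dotv x x)) [set 1]);
  last exact: closed_eq.
move=> v _; apply: (@continuous_comp _ _ _ (fun x : 'rV[R]_N => dotv x x) Num.sqrt).
  apply: continuous_big => [|i _ w]; first exact: add_continuous.
  by apply: continuousM; exact: coord_continuous.
exact: sqrt_continuous.
Qed.

(** * The uniform law on the sphere *)

(** The moment curve: any [N] of its points are linearly independent. *)
Definition moment_curve (R : realType) (N : nat) (t : nat) : 'rV[R]_N :=
  \row_(i < N) t%:R ^+ i.

(** A nonzero vector is the coefficient vector of a nonzero polynomial of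
    degree less than [N], which vanishes at fewer than [N] points. *)
Lemma card_moment_curve_orthogonal (R : realType) (N K : nat) (v : 'rV[R]_N) :
  v != 0 -> (#|[pred t : 'I_K | dotv (moment_curve R N t) v == 0%R]| <= N)%N.
Proof.
move=> v0; set A := [pred t | _].
have p0 : rVpoly v != 0.
  by apply: contra_neq v0 => h; rewrite -[v]rVpolyK h linear0.
suff h : (#|A| < size (rVpoly v))%N.
  exact: ltnW (leq_trans h (size_poly _ _)).
rewrite cardE -(size_map (fun t : 'I_K => (val t)%:R : R)).
apply: max_poly_roots => //.
- apply/allP => _ /mapP[t tA ->]; move: tA; rewrite mem_enum inE => /eqP tv.
  rewrite rootE -[eqbRHS]tv; apply/eqP.
  rewrite (horner_coef_wide _ (size_poly _ _)).
  by apply: eq_bigr => i _; rewrite mxE coef_rVpoly_ord mulrC.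
- rewrite map_inj_uniq ?enum_uniq// => s t /eqP.
  by rewrite eqr_nat => /eqP/val_inj.
Qed.

Lemma measure_setD_null (d : measure_display) (T : measurableType d)
    (R : realType) (mu : {measure set T -> \bar R}) (A Z : set T) :
  measurable A -> measurable Z -> mu Z = 0%E -> mu (A `\` Z) = mu A.
Proof.
move=> mA mZ Z0; rewrite [RHS](measureDI _ mA mZ).
rewrite [X in (_ + X)%E](_ : _ = 0%E) ?adde0//.
apply: subset_measure0 Z0 => //; exact: measurableI.
Qed.

Section uniform_law.
Variables (R : realType) (N : nat) (mu : probability (borelRow R N) R).
Hypothesis mu_unif : uniform_on_sphere mu.

(** The two hyperplanes, with normals rescaled to the unit sphere, are
    exchanged by a reflection. *)
Lemma uniform_hyperplane_eq (x y : 'rV[R]_N) : x != 0 -> y != 0 ->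
  mu [set v | dotv x v = 0] = mu [set v | dotv y v = 0].
Proof.
wlog : x y / dotv x x = dotv y y => [H x0 y0|xy _ _].
  have dot_gt0 (z : 'rV[R]_N) : z != 0 -> 0 < dotv z z.
    move=> z0; rewrite lt_neqAle eq_sym dotvv_eq0 z0 /=.
    by apply: sumr_ge0 => i _; rewrite -expr2 sqr_ge0.
  (* both normals are normalized, so that they have the same length *)
  pose a (z : 'rV[R]_N) : R := (Num.sqrt (dotv z z))^-1.
  have a0 z : z != 0 -> a z != 0.
    by move=> z0; rewrite invr_eq0 lt0r_neq0// sqrtr_gt0 dot_gt0.
  have aE z : z != 0 -> [set v | dotv z v = 0] = [set v | dotv (a z *: z) v = 0].
    move=> z0; apply/seteqP; split=> v /=; rewrite dotvZl.
      by move=> ->; rewrite mulr0.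
    by move/eqP; rewrite mulf_eq0 (negbTE (a0 _ z0)) /= => /eqP.
  have a1 z : z != 0 -> dotv (a z *: z) (a z *: z) = 1.
    move=> z0; rewrite dotvZl dotvC dotvZl mulrA -expr2 /a exprVn sqr_sqrtr ?ltW ?dot_gt0//.
    by rewrite mulVf// lt0r_neq0 ?dot_gt0.
  rewrite (aE x x0) (aE y y0); apply: H; rewrite ?scaler_eq0 ?negb_or ?a0//.
  by rewrite !a1.
have [_ /(_ _ (reflmx_orthogonal (x - y)) _ (measurable_dotv_eq0 x))] := mu_unif.
move=> <-; congr (mu _); apply/seteqP; split=> v /=;
  by rewrite dotv_mulmxr tr_reflmx mulmx_reflmxB.
Qed.

(** The uniform law is carried by the sphere. *)
Lemma uniform_setI_sphere (A : set (borelRow R N)) : measurable A ->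
  mu (A `&` @unit_sphere R N) = mu A.
Proof.
have mS := @measurable_unit_sphere R N.
have S0 : mu (~` @unit_sphere R N) = 0%E.
  by rewrite probability_setC// mu_unif.1 subee.
move=> mA; rewrite -[@unit_sphere R N]setCK -setDE measure_setD_null//.
exact: measurableC.
Qed.

(** With [K] hyperplanes orthogonal to the points [moment_curve t], [t < K], sum
    their indicators and integrate over the sphere: the integral is [K] times the
    common measure, and the integrand is at most [N]. *)
Lemma uniform_hyperplane (x : 'rV[R]_N) : x != 0 ->
  mu [set v | dotv x v = 0] = 0%E.
Proof.
move=> x0; set c := mu _.
have moment_neq0 t : moment_curve R N t != 0.
  have [i _] : exists i, x ord0 i != 0 by apply/rV0Pn.
  have N0 : (0 < N)%N := leq_ltn_trans (leq0n _) (ltn_ord i).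
  by apply/rV0Pn; exists (Ordinal N0); rewrite mxE expr0 oner_neq0.
have cfin : c \is a fin_num by apply: fin_num_measure; exact: measurable_dotv_eq0.
pose H t : set (borelRow R N) := [set v | dotv (moment_curve R N t) v = 0].
have mH t : measurable (H t) by exact: measurable_dotv_eq0.
have mS := @measurable_unit_sphere R N.
have cE t : mu (H t `&` @unit_sphere R N) = c.
  by rewrite uniform_setI_sphere//; exact: uniform_hyperplane_eq.
have cK (K : nat) : (K%:R%:E * c <= N%:R%:E)%E.
  have -> : (K%:R%:E * c = \int[mu]_(v in @unit_sphere R N) \sum_(t < K) (\1_(H t) v)%:E)%E.
    rewrite ge0_integral_sum//.
    - under eq_bigr do rewrite integral_indic//= cE.
      by rewrite -(fineK cfin) sumEFin sumr_const card_ord -EFinM mulr_natl.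
    - move=> t; apply/measurable_EFinP; exact: measurable_indic.
  apply: (@le_trans _ _ (\int[mu]_(v in @unit_sphere R N) (cst N%:R%:E v))%E).
    apply: ge0_le_integral => //.
    - by move=> v _; apply: sume_ge0.
    - by apply: emeasurable_sum => t; apply/measurable_EFinP; exact: measurable_indic.
    - move=> v Sv; rewrite sumEFin lee_fin.
      have := @card_moment_curve_orthogonal R N K v (unit_sphere_neq0 Sv).
      rewrite -(ler_nat R); apply: le_trans; rewrite -sum1_card natr_sum [leRHS]big_mkcond /=.
      apply: ler_sum => t _; rewrite indicE; case: (boolP (v \in H t)) => [|_].
        by rewrite in_setE => vH; rewrite ifT//; apply/eqP.
      by case: ifP.
  rewrite integral_cst// [X in (_ * X)%E](_ : _ = 1%E) ?mule1//.
  exact: mu_unif.1.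
have c0 : (0 <= c)%E by exact: measure_ge0.
move: cK; rewrite -(fineK cfin) => cK; congr EFin.
apply/eqP; rewrite eq_le fine_ge0// andbT leNgt; apply/negP => c_gt0.
have := archi_boundP (divr_ge0 (ler0n R N) (ltW c_gt0)).
by rewrite ltr_pdivrMr// ltNge -lee_fin EFinM cK.
Qed.

(** The reflection along [x] preserves the sign of [dotv y v] and reverses that
    of [dotv x v], so it exchanges agreement and disagreement of the two signs
    outside a null set. *)
Lemma uniform_sign_disagree (x y : 'rV[R]_N) : x != 0 -> dotv x y = 0 ->
  mu [set v | (0 <= dotv x v) != (0 <= dotv y v)] = (2^-1)%:E.
Proof.
move=> x0 xy; set D : set (borelRow R N) := [set v | _].
have mD : measurable D by exact: measurable_sign_disagree.
pose Z : set (borelRow R N) := [set v | dotv x v = 0].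
have mZ : measurable Z by exact: measurable_dotv_eq0.
have Z0 : mu Z = 0%E by exact: uniform_hyperplane.
pose D' : set (borelRow R N) := [set v | (0 <= - dotv x v) != (0 <= dotv y v)].
have D'E : (fun v : 'rV[R]_N => v *m reflmx x) @^-1` D = D'.
  have xx : dotv x x != 0 by rewrite dotvv_eq0.
  apply/seteqP; split=> v;
    rewrite /D /D' /= !dotv_mulmxr tr_reflmx !mulmx_reflmx !dotvBl !dotvZl;
    by rewrite mulfK// (dotvC y x) xy mulr0 mul0r mul0r subr0 mulr_natl mulr2n opprD addNKr.
have DD' : mu D = mu D' by rewrite -D'E mu_unif.2//; exact: reflmx_orthogonal.
have mD' : measurable D'.
  rewrite (_ : D' = [set v | (0 <= dotv (- x) v) != (0 <= dotv y v)]).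
    exact: measurable_sign_disagree.
  by apply/seteqP; split=> v; rewrite /D' /= dotvNl.
have : mu D = (1 - mu D)%E.
  rewrite -probability_setC// -(measure_setD_null (measurableC mD) mZ Z0).
  rewrite {1}DD' -(measure_setD_null mD' mZ Z0); congr (mu _).
  have signN v : ~ Z v -> (0 <= - dotv x v) = ~~ (0 <= dotv x v).
    by move=> /eqP vZ; rewrite oppr_ge0 -ltNge lt_neqAle vZ.
  apply/seteqP; split=> v [+ vZ]; rewrite /D' /D /= signN// => h; split=> //;
    by move: h; rewrite /= ?signN//; case: (0 <= dotv x v); case: (0 <= dotv y v).
have [r ->] : exists r, mu D = r%:E.
  by exists (fine (mu D)); rewrite fineK//; exact: fin_num_measure.
by rewrite -EFinB => -[h]; congr EFin; lra.
Qed.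

End uniform_law.

(** * The law of independent fair bits *)

(** The union bound over a finite family. *)
Lemma measure_bigsetU_le (d : measure_display) (T : measurableType d)
    (R : realType) (mu : {measure set T -> \bar R}) (I : Type) (r : seq I)
    (Q : pred I) (F : I -> set T) :
  (forall i, measurable (F i)) ->
  (mu (\big[setU/set0]_(i <- r | Q i) F i) <= \sum_(i <- r | Q i) mu (F i))%E.
Proof.
move=> mF; elim: r => [|i r IH]; first by rewrite !big_nil measure0.
rewrite !big_cons; case: ifP => // _.
apply: le_trans (leeD (lexx _) IH).
by apply: measureU2 => //; exact: bigsetU_measurable.
Qed.

(** Independent random variables [theta j], each falling in [D] with probability
    [1/2]; [bits] records which of them do. *)
Section independent_bits.
Variables (R : realType) (d d' : measure_display) (T : measurableType d).
Variables (T' : measurableType d') (P : probability T R) (m : nat).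
Variables (theta : 'I_m -> {RV P >-> T'}) (D : set T').
Hypotheses (ind : mutually_independent theta) (mD : measurable D).
Hypothesis half : forall j, P (theta j @^-1` D) = (2^-1)%:E.

Let bits (w : T) : {ffun 'I_m -> bool} := [ffun j => theta j w \in D].

Let A (b : {ffun 'I_m -> bool}) j := if b j then D else ~` D.

Let mA b j : measurable (A b j).
Proof. by rewrite /A; case: (b j) => //; exact: measurableC. Qed.

Let bits_bigcap (b : {ffun 'I_m -> bool}) :
  [set w | bits w = b] = \bigcap_(j in [set` [set: 'I_m]%SET]) theta j @^-1` A b j.
Proof.
apply/seteqP; split=> w /=.
  move=> bE j _; rewrite /A -bE /= ffunE; case: ifPn; first by rewrite inE.
  by rewrite notin_setE.
move=> h; apply/ffunP => j; have := h j; rewrite /= finset.in_setT => /(_ isT).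
rewrite ffunE /A; case: (b j) => /=; first exact: mem_set.
exact: memNset.
Qed.

Let measurable_bits_eq b : measurable [set w | bits w = b].
Proof.
rewrite bits_bigcap; apply: fin_bigcap_measurable => // j _.
exact: measurable_funPTI.
Qed.

Let bits_bigsetU (Q : pred {ffun 'I_m -> bool}) :
  [set w | Q (bits w)] = \big[setU/set0]_(b in Q) [set w | bits w = b].
Proof.
rewrite -bigcup_pred; apply/seteqP; split=> w /=; first by exists (bits w).
by case=> b Qb ->.
Qed.

Lemma measurable_bits (Q : pred {ffun 'I_m -> bool}) :
  measurable [set w | Q (bits w)].
Proof. by rewrite bits_bigsetU; exact: bigsetU_measurable. Qed.

Lemma prob_bits_eq (b : {ffun 'I_m -> bool}) :
  P [set w | bits w = b] = (2^-1 ^+ m)%:E.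
Proof.
rewrite bits_bigcap ind//.
rewrite (eq_bigr (fun=> (2^-1)%:E)) => [|j _].
  rewrite (eq_bigl xpredT) => [|j]; last by rewrite finset.in_setT.
  by rewrite prodEFin prodr_const card_ord.
rewrite /A; case: (b j) => //.
rewrite preimage_setC probability_setC ?half; last first.
  exact: measurable_funPTI.
by rewrite -EFinB; congr EFin; lra.
Qed.

Lemma prob_bits_le (Q : pred {ffun 'I_m -> bool}) :
  (P [set w | Q (bits w)] <= (#|Q|%:R * 2^-1 ^+ m)%:E)%E.
Proof.
rewrite bits_bigsetU.
apply: (le_trans (measure_bigsetU_le _ _ _ _)) => //.
rewrite (eq_bigr (fun=> (2^-1 ^+ m)%:E)) => [|b _]; last exact: prob_bits_eq.
by rewrite sumEFin sumr_const mulr_natl.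
Qed.

End independent_bits.

(** * The restricted isometry property *)

Lemma dhammingC (R : realType) (m : nat) (u v : hamming_cube m) :
  dhamming R u v = dhamming R v u.
Proof.
by rewrite /dhamming; congr (_%:R / _); apply: eq_card => i;
  apply/idP/idP => /set_mem h; apply/mem_set; rewrite /= eq_sym.
Qed.

Lemma dgeo_orthogonal (R : realType) (N : nat) (x y : 'rV[R]_N) :
  dotv x y = 0 -> dgeo x y = 1 / 2.
Proof.
by move=> xy; rewrite /dgeo xy acos0 mulrAC divff// gt_eqF// pi_gt0.
Qed.

Lemma dgeoxx (R : realType) (N : nat) (x : 'rV[R]_N) :
  dotv x x = 1 -> dgeo x x = 0.
Proof. by move=> xx; rewrite /dgeo xx acos1 mul0r. Qed.

Lemma dhammingxx (R : realType) (m : nat) (u : hamming_cube m) :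
  dhamming R u u = 0.
Proof.
rewrite /dhamming eq_card0 ?mul0r// => i; apply/negbTE; rewrite notin_setE /=.
by rewrite eqxx.
Qed.

(** Two orthogonal vectors [x], [y] with [x] nonzero, and independent uniform
    directions [theta j]. *)
Section onebit_pair.
Variables (R : realType) (N m : nat) (d : measure_display).
Variables (T : measurableType d) (P : probability T R).
Variables (theta : 'I_m -> {RV P >-> borelRow R N}) (x y : 'rV[R]_N).
Hypotheses (x0 : x != 0) (xy0 : dotv x y = 0).
Hypothesis ind : mutually_independent theta.
Hypothesis unif : forall j, uniform_on_sphere (distribution P (theta j)).

Let B w := @onebit_map R N m (fun j => theta j w).
Let D : set (borelRow R N) := [set v | (0 <= dotv x v) != (0 <= dotv y v)].

(** The tail event, on the disagreement bits of [x] and [y]. *)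
Let tail (delta c : R) : pred {ffun 'I_m -> bool} :=
  [pred b : {ffun 'I_m -> bool} |
    delta < c * (#|[pred i | b i]|%:R / m%:R - 1 / 2)].

Let tailE (delta c : R) :
  [set w | delta < c * (dhamming R (B w x) (B w y) - 1 / 2)] =
  [set w | tail delta c [ffun j => theta j w \in D]].
Proof.
suff E w : dhamming R (B w x) (B w y) =
    #|[pred i | [ffun j => theta j w \in D] i]|%:R / m%:R.
  by apply/seteqP; split=> w; rewrite /tail /= E.
rewrite /dhamming; congr (_%:R / _); apply: eq_card => i.
rewrite [RHS]inE [in RHS]ffunE /=.
by apply/idP/idP => [/set_mem /=|/set_mem] h; apply/mem_set; move: h;
  rewrite /D /= !ffunE.
Qed.

Lemma measurable_hamming_tail (delta c : R) :
  measurable [set w | delta < c * (dhamming R (B w x) (B w y) - 1 / 2)].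
Proof.
rewrite tailE; apply: measurable_bits; exact: measurable_sign_disagree.
Qed.

Lemma prob_hamming_tail (delta c : R) : 0 <= delta -> c = 1 \/ c = -1 ->
  (P [set w | (delta < c * (dhamming R (B w x) (B w y) - 1 / 2))%R]
    <= (expR (- (2 * m%:R * delta ^+ 2)))%:E)%E.
Proof.
move=> d0 hc; rewrite tailE.
apply: (le_trans (prob_bits_le ind _ _ _)).
- exact: measurable_sign_disagree.
- move=> j; exact: (uniform_sign_disagree (unif j) x0 xy0).
rewrite lee_fin exprVn ler_pdivrMr ?exprn_gt0// mulrC.
exact: card_tail_le.
Qed.

End onebit_pair.

Theorem theorem5p1 (R : realType) (N n m : nat) (delta epsilon : R)
  (X : set 'rV[R]_N)
  (d : measure_display) (T : measurableType d) (P : probability T R)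
  (theta : 'I_m -> {RV P >-> borelRow R N}) :
  0 < delta < 1 / 2 ->
  0 < epsilon < 1 ->
  (X #= `I_n)%card ->
  X `<=` @unit_sphere R N ->
  pairwise_orthogonal_set X ->
  mutually_independent theta ->
  (forall j, uniform_on_sphere (distribution P (theta j))) ->
  ln (n%:R ^+ 2 / epsilon) / (2 * delta ^+ 2) <= m%:R ->
  ((1 - epsilon)%:E <=
     P [set w | has_RIP delta X (onebit_map (fun j => theta j w))])%E.
Proof.
move=> /andP[d0 _] /andP[e0 _] cardX XS Xorth ind unif m_ge.
have [f fX] : exists f : nat -> 'rV[R]_N, f @` `I_n = X.
  move: cardX; rewrite card_eq_sym => /card_set_bijP[f [fI _ fS]].
  by exists f; apply/seteqP; split => // _ [i iI <-]; exact: fI.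
have Xf (i : 'I_n) : X (f i) by rewrite -fX; exists i => /=.
pose B w := @onebit_map R N m (fun j => theta j w).
(* of the two ordered versions of a pair of indices, the increasing one carries
   the upper tail and the decreasing one the lower tail *)
pose c (i j : 'I_n) : R := if (i < j)%N then 1 else -1.
have cP i j : c i j = 1 \/ c i j = -1 by rewrite /c; case: ifP; [left|right].
pose bad (p : 'I_n * 'I_n) : set T := if f p.1 == f p.2 then set0 else
  [set w | delta < c p.1 p.2 * (dhamming R (B w (f p.1)) (B w (f p.2)) - 1 / 2)].
have orth (p : 'I_n * 'I_n) : f p.1 != f p.2 -> dotv (f p.1) (f p.2) = 0.
  by move=> /eqP ne; exact: Xorth.
have mbad p : measurable (bad p).
  rewrite /bad; case: ifPn => // ne; exact: measurable_hamming_tail.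
have Pbad p : (P (bad p) <= (expR (- (2 * m%:R * delta ^+ 2)))%:E)%E.
  rewrite /bad; case: ifPn => [_|ne]; first by rewrite measure0 lee_fin expR_ge0.
  apply: prob_hamming_tail => //; [|exact: orth|exact: ltW].
  exact/unit_sphere_neq0/XS.
have RIPE : [set w | has_RIP delta X (B w)] =
    ~` \big[setU/set0]_(p : 'I_n * 'I_n) bad p.
  rewrite -bigcup_pred; apply/seteqP; split=> w /=.
    move=> rip [[i j] _]; rewrite /bad /=; case: ifPn => // ne /= tail.
    have := rip _ _ (Xf i) (Xf j); rewrite dgeo_orthogonal ?(orth (i, j))//.
    rewrite leNgt => /negP; apply; apply: lt_le_trans tail _.
    case: (cP i j) => ->; first by rewrite mul1r ler_norm.
    by rewrite mulN1r -normrN ler_norm.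
  move=> good x y Xx Xy.
  have [<-|neq] := eqVneq x y.
    rewrite dhammingxx dgeoxx; first by rewrite subrr normr0 ltW.
    exact/dotvv_unit_sphere/XS.
  rewrite dgeo_orthogonal; last by apply: Xorth => //; exact/eqP.
  move: (Xx) (Xy) neq; rewrite -fX => -[i + <-] [j + <-] /= => ltin ltjn neq.
  pose i' := Ordinal ltin; pose j' := Ordinal ltjn.
  have nottail (k l : 'I_n) : f k != f l ->
      c k l * (dhamming R (B w (f k)) (B w (f l)) - 1 / 2) <= delta.
    move=> kl; rewrite leNgt; apply/negP => tail; apply: good.
    by exists (k, l) => //=; rewrite /bad /= (negbTE kl).
  have hij := nottail i' j' neq.
  have hji : c j' i' * (dhamming R (B w (f i)) (B w (f j)) - 1 / 2) <= delta.
    by rewrite dhammingC; apply: (nottail j' i'); rewrite eq_sym.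
  (* the two one-sided bounds, for (i, j) and (j, i), give the two-sided one *)
  move: hij hji; rewrite /c /=; case: (ltngtP i j) => [ij|ij|ij].
  - by rewrite !mul1r mulN1r => h1 h2; rewrite ler_norml lerNl h2 h1.
  - by rewrite !mul1r mulN1r => h1 h2; rewrite ler_norml lerNl h1 h2.
  - by move: neq; rewrite ij eqxx.
have mbads : measurable (\big[setU/set0]_(p : 'I_n * 'I_n) bad p).
  by apply: bigsetU_measurable => p _; exact: mbad.
rewrite RIPE probability_setC// EFinB leeB//.
apply: (le_trans (measure_bigsetU_le _ _ _ mbad)).
apply: (le_trans (lee_sum _ (fun p _ => Pbad p))).
rewrite sumEFin lee_fin sumr_const -[leLHS]mulr_natl card_prod card_ord natrM -expr2.
have [->|n0] := eqVneq n 0%N; first by rewrite expr0n mul0r ltW.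
have n2 : 0 < n%:R ^+ 2 :> R by rewrite exprn_gt0// ltr0n lt0n.
rewrite expRN ler_pdivrMr ?expR_gt0// mulrC -ler_pdivrMr//.
rewrite -[leLHS]lnK ?posrE ?divr_gt0// ler_expR.
move: m_ge; rewrite ler_pdivrMr; last by rewrite mulr_gt0// exprn_gt0.
by move=> /le_trans; apply; rewrite mulrCA mulrA.
Qed.
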